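(* Let $\mathcal{I}=\{J\times\mathbb{R}^M; W_k: k\in T\}$ be the IFS described in the context, and suppose there are constants $0<C_k<1$ ($k\in T$) such that for every $k\in T$ and all $(t_1,\boldsymbol{z}_1),(t_2,\boldsymbol{z}_2)\in J\times\mathbb{R}^M$, $$d(W_k(t_1,\boldsymbol{z}_1),W_k(t_2,\boldsymbol{z}_2))\le C_k\, d((t_1,\boldsymbol{z}_1),(t_2,\boldsymbol{z}_2)).$$ Let $(p_1,\dots,p_{N-1})$ be a probability vector corresponding to $\mathcal{I}$ and let $\mu_*$ be the invariant measure corresponding to $\mathcal{I}$ and this probability vector. Then $$\dim_H(\mu_* )\le\frac{\sum_{k\in T}p_k\log p_k}{\sum_{k\in T}p_k\log C_k}.$$
   Context: Setting: $M\ge 1$, $(x_i,\boldsymbol{y}_i)\in\mathbb{R}\times\mathbb{R}^M$ ($i=1,\dots,N$) are data points with $x_1<x_2<\dots<x_N$, $T=\{1,\dots,N-1\}$, $J=[x_1,x_N]$, $J_k=[x_k,x_{k+1}]$. For $k\in T$, $P_k(t)=a_kt+d_k$ is the affine map $J\to J_k$ with $P_k(x_1)=x_k$, $P_k(x_N)=x_{k+1}$; each $P_k$ is contractive (so $N\ge 3$). For $k\in T$, $\alpha_k\in(-1,1)$ and $q_k:J\to\mathbb{R}^M$ is continuous with $q_k(x_1)=\boldsymbol{y}_k-\alpha_k\boldsymbol{y}_1$, $q_k(x_N)=\boldsymbol{y}_{k+1}-\alpha_k\boldsymbol{y}_N$; put $F_k(t,\boldsymbol{z})=\alpha_k\boldsymbol{z}+q_k(t)$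 and $W_k(t,\boldsymbol{z})=(P_k(t),F_k(t,\boldsymbol{z}))$ on $J\times\mathbb{R}^M$. The IFS $\{J\times\mathbb{R}^M;W_1,\dots,W_{N-1}\}$ has a unique attractor, which is the graph $G(h)$ of a continuous function $h:J\to\mathbb{R}^M$, the fractal interpolation function (FIF), satisfying $h(t)=\alpha_k h(P_k^{-1}(t))+q_k(P_k^{-1}(t))$ for $t\in J_k$, $k\in T$. $d$ is the Euclidean metric on $J\times\mathbb{R}^M\subset\mathbb{R}^{M+1}$. A probability vector $(p_1,\dots,p_{N-1})$ has $p_k>0$ and $\sum_{k\in T}p_k=1$. The invariant measure $\mu_*$ is the unique Borel probability measure supported on $G(h)$ with $\mu_*=\sum_{k\in T}p_k\,\mu_*\circ W_k^{-1}$. For a Borel probability measure $\mu$, $\dim_H(\mu)=\inf\{\dim_H(F): F \text{ Borel},\ \mu(F)>0\}$, where $\dim_H(F)$ is the Hausdorff dimension of $F$. *)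

(* Defs.v *)
From HB Require Import structures.
From mathcomp Require Import all_boot all_order all_algebra.
From mathcomp Require Import all_classical all_reals all_analysis.

Set Implicit Arguments.
Unset Strict Implicit.
Unset Printing Implicit Defensive.

Import Order.TTheory GRing.Theory Num.Theory.
Import numFieldNormedType.Exports.

Local Open Scope classical_set_scope.
Local Open Scope ring_scope.

(* The distance is an explicit parameter because the library metric on a
   product is the sup metric, while Euclidean diameters are wanted below. *)
Section Hausdorff_dimension.
Variables (R : realType) (X : Type) (dist : X -> X -> R).

(* -oo on the empty set. *)
Definition diam (U : set X) : \bar R :=
  ereal_sup [set (dist z.1 z.2)%:E | z in U `*` U].

(* The empty set contributes 0 even when s = 0, so that finite covers are
   sequences of sets that are eventually empty. *)
Definition diam_pow (s : R) (U : set X) : \bar R :=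
  if `[< U = set0 >] then 0%E else poweR (diam U) s.

Definition delta_cover (delta : R) (F : set X) (U : nat -> set X) : Prop :=
  F `<=` \bigcup_i U i /\ forall i, (diam (U i) <= delta%:E)%E.

Definition hausdorff_premeasure (s delta : R) (F : set X) : \bar R :=
  ereal_inf [set (\sum_(0 <= i <oo) diam_pow s (U i))%E
            | U in delta_cover delta F].

(* The premeasure is nonincreasing in delta: its limit at 0 is a supremum. *)
Definition hausdorff_measure (s : R) (F : set X) : \bar R :=
  ereal_sup [set hausdorff_premeasure s delta F
            | delta in [set delta : R | 0 < delta]].

Definition hausdorff_dim (F : set X) : \bar R :=
  ereal_inf [set s%:E | s in
    [set s : R | 0 <= s /\ hausdorff_measure s F = 0%E]].

End Hausdorff_dimension.

(* Ambient space R x R^M; its product topology is the Euclidean one. *)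
Notation ambient R M := (R * 'rV[R]_M)%type.

Notation borel_space R M := (g_sigma_algebraType (@open (ambient R M))).

Definition euclid_dist (R : realType) (M : nat) (u v : ambient R M) : R :=
  Num.sqrt ((u.1 - v.1) ^+ 2 + \sum_(j < M) (u.2 0 j - v.2 0 j) ^+ 2).

Definition measure_hausdorff_dim (R : realType) (M : nat)
    (mu : set (borel_space R M) -> \bar R) : \bar R :=
  ereal_inf [set hausdorff_dim (@euclid_dist R M) F | F in
    [set F : set (borel_space R M) | measurable F /\ (0 < mu F)%E]].

(* The k-th subinterval, k : 'I_n, has endpoints of index k and k.+1. *)
Definition left_idx (n : nat) (k : 'I_n) : 'I_n.+1 := widen_ord (leqnSn n) k.
Definition right_idx (n : nat) (k : 'I_n) : 'I_n.+1 := lift ord0 k.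

(* There are N = n.+1 data points, indexed from 0, and n = N - 1 maps.
   The functions fq k are only meaningful on [x_1, x_N]. *)
Record fif_data (R : realType) (n M : nat) := FifData {
  fx : 'I_n.+1 -> R;
  fy : 'I_n.+1 -> 'rV[R]_M;
  fa : 'I_n -> R;
  fd : 'I_n -> R;
  falpha : 'I_n -> R;
  fq : 'I_n -> R -> 'rV[R]_M;
  fx_lt : forall i j : 'I_n.+1, (i < j)%N -> fx i < fx j;
  fP_left : forall k, fa k * fx ord0 + fd k = fx (left_idx k);
  fP_right : forall k, fa k * fx ord_max + fd k = fx (right_idx k);
  falpha_lt1 : forall k, -1 < falpha k < 1;
  fq_cont : forall k, {within `[fx ord0, fx ord_max], continuous (fq k)};
  fq_left : forall k,
    fq k (fx ord0) = fy (left_idx k) - falpha k *: fy ord0;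
  fq_right : forall k,
    fq k (fx ord_max) = fy (right_idx k) - falpha k *: fy ord_max
}.

Section FIF.
Variables (R : realType) (n M : nat) (D : fif_data R n M).

Definition domJ : set R := `[fx D ord0, fx D ord_max].

Definition ifs_space : set (ambient R M) := domJ `*` setT.

Definition mapP (k : 'I_n) (t : R) : R := fa D k * t + fd D k.

Definition mapF (k : 'I_n) (u : ambient R M) : 'rV[R]_M :=
  falpha D k *: u.2 + fq D k u.1.

Definition mapW (k : 'I_n) (u : ambient R M) : ambient R M :=
  (mapP k u.1, mapF k u).

Definition is_attractor (K : set (ambient R M)) : Prop :=
  [/\ K !=set0, compact K, K `<=` ifs_space &
      K = \bigcup_(k : 'I_n) (mapW k @` K)].

Definition graphJ (h : R -> 'rV[R]_M) : set (ambient R M) :=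
  [set (t, h t) | t in domJ].

Definition is_fif (h : R -> 'rV[R]_M) : Prop :=
  {within domJ, continuous h} /\ is_attractor (graphJ h).

Definition is_probability_vector (p : 'I_n -> R) : Prop :=
  (forall k, 0 < p k) /\ \sum_(k < n) p k = 1.

(* mapW k is a map on ifs_space only, so preimages are taken there: outside,
   fq k is arbitrary and need not be measurable. *)
Definition is_invariant_measure (h : R -> 'rV[R]_M) (p : 'I_n -> R)
    (mu : probability (borel_space R M) R) : Prop :=
  mu (graphJ h) = 1%E /\
  forall A : set (borel_space R M), measurable A ->
    mu A = (\sum_(k < n) (p k)%:E * mu (ifs_space `&` mapW k @^-1` A))%E.

End FIF.

(* Main.v *)
Require Import Defs.
From mathcomp Require Import all_boot all_order all_algebra.
From mathcomp Require Import all_classical all_reals all_analysis.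
From mathcomp Require Import ring lra.
Import Order.TTheory GRing.Theory Num.Theory.
Import numFieldNormedType.Exports.
Local Open Scope classical_set_scope.
Local Open Scope ring_scope.

(** The strategy is to show that every [s] larger than the ratio is an upper
bound: a Borel set [F] with [0 < mu F] and [hausdorff_measure s F = 0] is
produced ([exists_hausdorff_null]).

Write [K] for the graph of the fractal interpolation function and, for a word
[w = k_1 ... k_m], write [p_w] and [C_w] for the products of the [p k] and of
the [C k], and [K_w] for the image of [K] by [W_{k_1} o ... o W_{k_m}].  The
diameter of [K_w] is at most [C_w] times that of [K].  Under independent
letters of law [p], the average of [x k = s ln (C k) - ln (p k)] is negative
exactly when [s] exceeds the ratio.  So for most words [C_w ^ s] is
exponentially smaller than [p_w].

This is made quantitative by an exponential moment: there are
[0 < theta <= 1] and [0 < r < 1] such that the average of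
[exp (theta * x k)] is at most [r ^ 2] ([exp_moment_lt1]).  Call [w], of
length [m], good when the product of the [exp (theta * x k)] along [w] is at
most [r ^ m].  By Markov's inequality the bad words have total weight at most
[r ^ m], while the good ones satisfy [sum C_w ^ s <= r ^ m]
([sum_good_bad]).

The union [E_m] of the good [K_w] of length [m] has measure at least the sum
of the corresponding [p_w] ([measure_cylinders_ge]): this inequality follows
from the invariance of [mu] by induction on [m], and does not require the
[K_w] to be disjoint.  Hence the complement of [E_m] has measure at most
[r ^ m], and the intersection [F] of the [E_m] along a sparse sequence of
lengths has positive measure.  For each such [m], [F] is covered by the good
[K_w], whose diameters tend to 0 and whose [s]-powers sum to at most
a constant times [r ^ m]; so its [s]-dimensional Hausdorff measure is zero. *)

(** * Exponential moments *)

Lemma expR_le_quadratic {R : realType} (y : R) :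
  y <= 2^-1 -> expR y <= 1 + y + 2 * y ^+ 2.
Proof.
move=> yle.
have y1 : 0 < 1 - y by lra.
have e1 : expR y * (1 - y) <= 1.
  by rewrite -[leRHS](expRxMexpNx_1 y) ler_pM2l ?expR_gt0// expR_ge1Dx.
rewrite -(ler_pM2r y1); apply: (le_trans e1).
suff : 0 <= y ^+ 2 * (1 - 2 * y) by lra.
by apply: mulr_ge0; [exact: sqr_ge0|lra].
Qed.

(** The log-moment generating function vanishes at 0 with negative slope, so
the exponential moment is below 1 for some small [theta].  The bound is a
square so that Markov's inequality loses one factor [r] and keeps the other. *)
Lemma exp_moment_lt1 {R : realType} (I : finType) (p x : I -> R) :
  (forall k, 0 < p k) -> \sum_k p k = 1 -> \sum_k p k * x k < 0 ->
  exists theta r : R, [/\ 0 < theta, theta <= 1, 0 < r, r < 1 &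
    \sum_k p k * expR (theta * x k) <= r ^+ 2].
Proof.
move=> p0 p1 px.
set a := - \sum_k p k * x k.
have a0 : 0 < a by rewrite oppr_gt0.
pose K : R := \sum_k `|x k|; pose B := \sum_k p k * x k ^+ 2.
have K0 : 0 <= K by apply: sumr_ge0 => k _.
have B0 : 0 <= B by apply: sumr_ge0 => k _; rewrite mulr_ge0 ?sqr_ge0 ?ltW.
(* With [t] below the first bound, [expR_le_quadratic] applies to every
   [t * x k]; with [t] below the second, the linear term wins. *)
pose t := Num.min (2 * (K + 1))^-1 (a / (2 * (B + 1))).
have t0 : 0 < t by rewrite lt_min invr_gt0 divr_gt0//; lra.
have tK : t * K <= 2^-1 /\ t <= 1.
  have : t * (2 * (K + 1)) <= 1.
    by rewrite -ler_pdivlMr ?div1r ?ge_min ?lexx//; lra.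
  have : 0 <= t * K by rewrite mulr_ge0 ?(ltW t0).
  by move=> ? ?; split; nra.
have tB : t * B * 2 < a.
  have : t * (2 * (B + 1)) <= a.
    by rewrite -ler_pdivlMr ?ge_min ?lexx ?orbT//; lra.
  by lra.
set L := \sum_k p k * expR (t * x k).
have L1 : L < 1.
  apply: (@le_lt_trans _ _ (1 - t * a + 2 * t ^+ 2 * B)); last first.
    suff : t * (a - t * B * 2) > 0 by lra.
    by rewrite mulr_gt0// subr_gt0.
  rewrite -{1}p1 /a /B mulrN opprK !mulr_sumr -!big_split/=.
  apply: ler_sum => k _.
  have -> : p k + t * (p k * x k) + 2 * t ^+ 2 * (p k * x k ^+ 2) =
      p k * (1 + t * x k + 2 * (t * x k) ^+ 2) by ring.
  rewrite ler_pM2l// expR_le_quadratic//.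
  apply: (le_trans _ tK.1); rewrite ler_pM2l//.
  rewrite (le_trans (ler_norm _))// /K (bigD1 k)//= lerDl.
  by apply: sumr_ge0.
have L0 : 0 <= L by apply: sumr_ge0 => k _; rewrite mulr_ge0 ?expR_ge0// ltW.
(* Arithmetic-geometric inequality: [L <= ((1 + L) / 2) ^ 2]. *)
exists t, ((1 + L) / 2); split => //; [exact: tK.2|lra|lra|].
by have := sqr_ge0 (1 - L); rewrite -/L; lra.
Qed.

(** * Words and their weights *)

Section words.
Context {n : nat}.

(** The words of length [m] over the alphabet ['I_n], listed without
repetition. *)
Definition words (m : nat) : seq (seq 'I_n) :=
  iter m (fun ws => [seq k :: w | k <- enum 'I_n, w <- ws]) [:: [::]].

Lemma big_wordsS {R : nmodType} (m : nat) (P : pred (seq 'I_n))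
    (F : seq 'I_n -> R) :
  \sum_(w <- words m.+1 | P w) F w =
  \sum_(k < n) \sum_(w <- words m | P (k :: w)) F (k :: w).
Proof.
rewrite big_mkcond big_allpairs_dep big_enum/=.
by apply: eq_bigr => k _; rewrite -big_mkcond.
Qed.

Lemma size_words (m : nat) (w : seq 'I_n) : w \in words m -> size w = m.
Proof.
elim: m w => [|m IH] w; first by rewrite inE => /eqP ->.
by move=> /allpairsP[[k v]] /= [_ vm ->] /=; rewrite IH.
Qed.

Lemma sum_words_prod {R : comNzRingType} (g : 'I_n -> R) (m : nat) :
  \sum_(w <- words m) \prod_(k <- w) g k = (\sum_(k < n) g k) ^+ m.
Proof.
elim: m => [|m IH]; first by rewrite big_seq1 big_nil expr0.
rewrite big_wordsS exprS mulr_suml; apply: eq_bigr => k _.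
by rewrite -IH mulr_sumr; apply: eq_bigr => w _; rewrite big_cons.
Qed.

End words.

(** Bad words are rare by Markov's inequality.  On a good word the sum [X] of
the [x k] is nonpositive, so [X <= theta * X] because [theta <= 1], which turns
the bound on [exp (theta * X)] into one on [exp X]. *)
Lemma sum_good_bad {R : realType} {n : nat} (p x : 'I_n -> R) (theta r : R) :
  (forall k, 0 < p k) -> \sum_k p k = 1 ->
  0 < theta -> theta <= 1 -> 0 < r -> r < 1 ->
  \sum_k p k * expR (theta * x k) <= r ^+ 2 ->
  forall m : nat,
   let good := fun w => \prod_(k <- w) expR (theta * x k) <= r ^+ m in
   \sum_(w <- words m | ~~ good w) \prod_(k <- w) p k <= r ^+ m /\
   \sum_(w <- words m | good w) \prod_(k <- w) (p k * expR (x k)) <= r ^+ m.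
Proof.
move=> p0 p1 t0 t1 r0 r1 hr m good.
have pw0 (w : seq 'I_n) : 0 < \prod_(k <- w) p k by apply: prodr_gt0.
have rm0 : 0 < r ^+ m by rewrite exprn_gt0.
split.
- rewrite -(ler_pM2r rm0) -exprMn -expr2.
  apply: (@le_trans _ _ ((\sum_k p k * expR (theta * x k)) ^+ m)); last first.
    by apply: lerXn2r => //; rewrite nnegrE ?sqr_ge0// sumr_ge0// => k _;
      rewrite mulr_ge0 ?expR_ge0// ltW.
  rewrite -sum_words_prod [leRHS](bigID good) /= ler_wpDl//.
    by apply: sumr_ge0 => w _; apply: prodr_ge0 => k _;
      rewrite mulr_ge0 ?expR_ge0// ltW.
  rewrite mulr_suml; apply: ler_sum => w; rewrite /good -ltNge => bad.
  by rewrite big_split/= ler_pM2l ?ltW.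
- apply: (@le_trans _ _ (\sum_(w <- words m | good w)
      (\prod_(k <- w) p k) * r ^+ m)).
    apply: ler_sum => w; rewrite /good big_split/= ler_pM2l//.
    rewrite -!expR_sum -mulr_sumr => gw.
    apply: (le_trans _ gw); rewrite ler_expR.
    have : expR (theta * \sum_(i <- w) x i) <= 1.
      by rewrite (le_trans gw)// exprn_ile1// ltW.
    rewrite -expR0 ler_expR pmulr_rle0// => X0.
    by nra.
  rewrite -mulr_suml ger_pMl//.
  apply: (@le_trans _ _ (\sum_(w <- words m) \prod_(k <- w) p k)); last first.
    by rewrite sum_words_prod p1 expr1n.
  rewrite [leRHS](bigID good)/= lerDl.
  by apply: sumr_ge0 => w _; rewrite ltW.
Qed.

(** * Vanishing of a Hausdorff measure *)

Lemma diam_pow_ge0 {R : realType} {X : Type} (dist : X -> X -> R) (s : R)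
  (U : set X) : (0 <= diam_pow dist s U)%E.
Proof. by rewrite /diam_pow; case: ifP => // _; exact: poweR_ge0. Qed.

Lemma diam_le {R : realType} {X : Type} (dist : X -> X -> R) (U : set X)
    (b : R) :
  (forall u v, U u -> U v -> dist u v <= b) -> (diam dist U <= b%:E)%E.
Proof.
move=> Ub; apply: ge_ereal_sup => _ [[u v] [/= Uu Uv] <-].
by rewrite lee_fin; exact: Ub.
Qed.

Lemma diam_pow_le {R : realType} {X : Type} (dist : X -> X -> R) (s b : R)
    (U : set X) :
  (forall u v, 0 <= dist u v) -> 0 <= s -> 0 <= b ->
  (forall u v, U u -> U v -> dist u v <= b) ->
  (diam_pow dist s U <= (b `^ s)%:E)%E.
Proof.
move=> dist0 s0 b0 Ub; rewrite /diam_pow; case: ifPn => [_|/asboolPn U0].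
  by rewrite lee_fin powR_ge0.
have [u Uu] : U !=set0 by apply/set0P/eqP.
have dU : (diam dist U <= b%:E)%E by exact: diam_le.
have dU0 : (0 <= diam dist U)%E.
  apply: (@le_trans _ _ (dist u u)%:E); first by rewrite lee_fin.
  by apply: ereal_sup_ubound; exists (u, u).
rewrite -poweR_EFin gt0_ler_poweR// in_itv/= ?andbT ?leey ?dU0//.
by rewrite lee_fin b0.
Qed.

(** It suffices to have finite covers with explicit bounds [b] on the
diameters; they are completed into sequences by empty sets. *)
Lemma hausdorff_measure_eq0 {R : realType} {X : Type} (dist : X -> X -> R)
    (s : R) (F : set X) :
  (forall u v, 0 <= dist u v) -> 0 < s ->
  (forall delta e : R, 0 < delta -> 0 < e ->
    exists (I : eqType) (r : seq I) (U : I -> set X) (b : I -> R),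
    [/\ F `<=` \bigcup_(i in [set` r]) U i,
        forall i u v, U i u -> U i v -> dist u v <= b i,
        forall i, i \in r -> 0 <= b i <= delta &
        \sum_(i <- r) b i `^ s <= e]) ->
  hausdorff_measure dist s F = 0%E.
Proof.
move=> dist0 s0 covers.
have pre0 delta : 0 < delta -> hausdorff_premeasure dist s delta F = 0%E.
  move=> delta0; apply/eqP; rewrite eq_le; apply/andP; split; last first.
    apply: le_ereal_inf_tmp => _ [U _ <-].
    by apply: nneseries_ge0 => i _ _; exact: diam_pow_ge0.
  apply/lee_addgt0Pr => e e0; rewrite add0e.
  have [I [r [U [b [FU Ub bd sumb]]]]] := covers _ _ delta0 e0.
  pose V j := nth set0 (map U r) j.
  have Vcover : delta_cover dist delta F V.
    split.
      move=> x /FU[i /= ir Uix]; exists (index i r) => //=.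
      by rewrite /V (nth_map i) ?index_mem// nth_index.
    move=> j; apply: diam_le => u v; rewrite /V.
    have [jr|jr] := ltnP j (size r); last by rewrite nth_default ?size_map.
    case: r jr bd {FU sumb V} => // i0 r jr bd; rewrite (nth_map i0)// => Uu Uv.
    apply: (le_trans (Ub _ _ _ Uu Uv)).
    by have /andP[] := bd _ (mem_nth i0 jr).
  apply: ge_ereal_inf; eexists; first by exists V; [exact: Vcover|].
  rewrite (nneseries_split 0 (size r)); last by move=> *; exact: diam_pow_ge0.
  rewrite eseries0 ?adde0; last first.
    move=> j jr _; rewrite /diam_pow /V nth_default ?size_map//.
    by case: ifPn => // /asboolPn.
  apply: (@le_trans _ _ (\sum_(i <- r) (b i `^ s)%:E)%E); last first.
    by rewrite sumEFin lee_fin.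
  rewrite add0n -(size_map U) -(big_nth set0 xpredT (diam_pow dist s)) big_map.
  rewrite big_seq [leRHS]big_seq; apply: lee_sum => i ir.
  have /andP[bi0 _] := bd _ ir.
  by apply: diam_pow_le => //; [exact: ltW|exact: Ub].
rewrite /hausdorff_measure.
rewrite [X in ereal_sup X](_ : _ = [set 0%E]) ?ereal_sup1//.
apply/seteqP; split => [_ [delta /= d0 <-]|_ ->]; first by rewrite pre0.
by exists 1 => //=; rewrite pre0.
Qed.

(** * Topology of the iterated function system *)

Lemma euclid_dist_ge0 {R : realType} {M : nat} (u v : ambient R M) :
  0 <= euclid_dist u v.
Proof. exact: sqrtr_ge0. Qed.

Lemma compact_euclid_bounded {R : realType} {M : nat} (K : set (ambient R M)) :
  compact K ->
  exists2 d : R, 0 < d & forall u v, K u -> K v -> euclid_dist u v <= d.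
Proof.
move=> /compact_bounded[B [Breal KB]].
have [b b0 Kb] : exists2 b : R, 0 < b & forall u, K u -> `|u| <= b.
  exists (`|B| + 1); first by rewrite ltr_wpDl.
  by apply: KB; rewrite (le_lt_trans (ler_norm _))// ltrDl.
exists (Num.sqrt ((b + b) ^+ 2 + \sum_(j < M) (b + b) ^+ 2)).
  rewrite sqrtr_gt0 ltr_pwDl// ?exprn_gt0 ?addr_gt0//.
  by apply: sumr_ge0 => j _; exact: sqr_ge0.
move=> u v /Kb ub /Kb vb; apply: ler_wsqrtr.
have sq (a c : R) : `|a| <= b -> `|c| <= b -> (a - c) ^+ 2 <= (b + b) ^+ 2.
  by rewrite !ler_norml => /andP[? ?] /andP[? ?]; nra.
have [ub1 ub2] : `|u.1| <= b /\ `|u.2| <= b.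
  by apply/andP; rewrite -ge_max.
have [vb1 vb2] : `|v.1| <= b /\ `|v.2| <= b.
  by apply/andP; rewrite -ge_max.
have coord (z : 'rV[R]_M) j : `|z| <= b -> `|z 0 j| <= b.
  move=> zb; apply: le_trans zb.
  rewrite /Num.norm/= mx_normrE.
  exact: (le_bigmax _ (fun ij => `|z ij.1 ij.2|) (0, j)).
by apply: lerD; [exact: sq|apply: ler_sum => j _; apply: sq; exact: coord].
Qed.

Section IFS_topology.
Context {R : realType} {n M : nat} (D : fif_data R n M).

Lemma closed_ifs_space : closed (ifs_space D).
Proof.
have -> : ifs_space D = (@fst R 'rV[R]_M) @^-1` (domJ D).
  by apply/seteqP; split => [u []|u ?].
apply: closed_comp; last exact: interval_closed.
by move=> u _; exact: cvg_fst.
Qed.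

Lemma mapW_continuous (k : 'I_n) :
  {within ifs_space D, continuous (mapW D k)}.
Proof.
apply/subspace_continuousP => u [/= Ju _].
have c1 : x.1 @[x --> within (ifs_space D) (nbhs u)] --> u.1.
  by apply: cvg_within_filter; exact: cvg_fst.
have c2 : x.2 @[x --> within (ifs_space D) (nbhs u)] --> u.2.
  by apply: cvg_within_filter; exact: cvg_snd.
have cq : fq D k x.1 @[x --> within (ifs_space D) (nbhs u)] --> fq D k u.1.
  have /subspace_continuousP/(_ _ Ju) qk := @fq_cont _ _ _ D k.
  move=> A /qk Ak.
  have := @cvg_fst _ _ (nbhs u.1) (nbhs u.2) (nbhs_filter _) _ Ak.
  by apply: (@filterS _ (nbhs u)) => x Ax [Jx _]; exact: Ax.
have cP : Defs.mapP D k x.1 @[x --> within (ifs_space D) (nbhs u)] -->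
    Defs.mapP D k u.1.
  by apply: cvgD; [apply: cvgM => //; exact: cvg_cst|exact: cvg_cst].
have cF : mapF D k x @[x --> within (ifs_space D) (nbhs u)] --> mapF D k u.
  by apply: cvgD => //; apply: cvgZr.
exact: cvg_pair cP cF.
Qed.

(** These preimages occur in the invariance relation; being closed, they are
Borel, so that [mu] is monotone on them. *)
Lemma closed_preimage_mapW (k : 'I_n) (A : set (ambient R M)) :
  closed A -> closed (ifs_space D `&` mapW D k @^-1` A).
Proof.
move=> Ac; rewrite closed_setSI; last exact: closed_ifs_space.
by have /continuous_closedP := mapW_continuous k; apply.
Qed.

End IFS_topology.

(** * Cylinders and their measure *)

Section cylinders.
Context {R : realType} {n M : nat} (D : fif_data R n M).
Context (K : set (ambient R M)).

(** The image of [K] by the composite of the maps [mapW D k], [k] running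
through the letters of [w], the first letter being applied last. *)
Definition cylinder (w : seq 'I_n) : set (ambient R M) :=
  foldr (fun k A => mapW D k @` A) K w.

(** The union of the cylinders of the words of length [m] satisfying [P]. *)
Definition cylinders (m : nat) (P : pred (seq 'I_n)) : set (ambient R M) :=
  \bigcup_(w in [set` [seq w <- words m | P w]]) cylinder w.

Context (Kcompact : compact K) (Kspace : K `<=` ifs_space D).
Context (Kinv : forall k, mapW D k @` K `<=` K).

Lemma cylinder_sub (w : seq 'I_n) : cylinder w `<=` K.
Proof.
elim: w => //= k w IH; apply: subset_trans (Kinv k).
exact: image_subset.
Qed.

Lemma compact_cylinder (w : seq 'I_n) : compact (cylinder w).
Proof.
elim: w => //= k w IH; apply: continuous_compact => //.
apply: continuous_subspaceW (mapW_continuous D k).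
exact: subset_trans (cylinder_sub w) Kspace.
Qed.

Lemma closed_cylinders (m : nat) (P : pred (seq 'I_n)) :
  closed (cylinders m P).
Proof.
rewrite /cylinders bigcup_seq; apply: closed_bigsetU => w _.
by apply: compact_closed; [exact: norm_hausdorff|exact: compact_cylinder].
Qed.

Lemma cylinder_dist_le (C : 'I_n -> R) (d : R) :
  (forall k, 0 <= C k) ->
  (forall k u v, ifs_space D u -> ifs_space D v ->
     euclid_dist (mapW D k u) (mapW D k v) <= C k * euclid_dist u v) ->
  (forall u v, K u -> K v -> euclid_dist u v <= d) ->
  forall w u v, cylinder w u -> cylinder w v ->
    euclid_dist u v <= (\prod_(k <- w) C k) * d.
Proof.
move=> C0 hW Kd; elim=> [|k w IH] /= u v.
  by rewrite big_nil mul1r; exact: Kd.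
move=> [u' wu' <-] [v' wv' <-]; rewrite big_cons -mulrA.
apply: (le_trans (hW _ _ _ _ _)).
- exact/Kspace/(cylinder_sub w).
- exact/Kspace/(cylinder_sub w).
- by rewrite ler_wpM2l//; exact: IH.
Qed.

Lemma cylindersS_preimage (m : nat) (P : pred (seq 'I_n)) (k : 'I_n) :
  cylinders m (fun w => P (k :: w)) `<=`
  ifs_space D `&` mapW D k @^-1` cylinders m.+1 P.
Proof.
move=> u [w /= + wu]; rewrite mem_filter => /andP[Pw mw]; split.
  exact/Kspace/(cylinder_sub w).
exists (k :: w) => /=; last by exists u.
rewrite mem_filter Pw/=; apply/allpairsP; exists (k, w).
by rewrite mem_enum.
Qed.

End cylinders.

Lemma closed_borel_measurable {R : realType} {M : nat}
    (A : set (borel_space R M)) :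
  closed (A : set (ambient R M)) -> measurable A.
Proof.
move=> Ac; rewrite -(setCK A); apply: measurableC.
by apply: sub_sigma_algebra; exact: closed_openC.
Qed.

(** By induction on [m]: the preimage of a union of cylinders by [mapW D k]
contains the cylinders of the words obtained by removing a first letter [k].
Only an inequality is needed, so overlaps between cylinders are harmless. *)
Lemma measure_cylinders_ge {R : realType} {n M : nat} (D : fif_data R n M)
    (h : R -> 'rV[R]_M) (p : 'I_n -> R) (mu : probability (borel_space R M) R) :
  is_fif D h -> (forall k, 0 <= p k) -> is_invariant_measure D h p mu ->
  forall (m : nat) (P : pred (seq 'I_n)),
  ((\sum_(w <- words m | P w) \prod_(k <- w) p k)%:E <=
    mu (cylinders D (graphJ D h) m P))%E.
Proof.
move=> [_ [_ Kc Ks Kinv]] p0 [mu1 muinv]; set K := graphJ D h.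
have Kk k : mapW D k @` K `<=` K.
  by move=> u Wu; rewrite /K Kinv; exists k.
have mcyl m P : measurable (cylinders D K m P : set (borel_space R M)).
  by apply: closed_borel_measurable; exact: closed_cylinders.
elim=> [|m IH] P.
  rewrite big_mkcond big_seq1 big_nil; case: ifPn => P0 //.
  rewrite -mu1; apply: le_measure; rewrite ?inE//.
    by apply: closed_borel_measurable; apply: compact_closed => //;
      exact: norm_hausdorff.
  by move=> u Ku; exists [::] => //=; rewrite P0 inE.
rewrite muinv// big_wordsS -sumEFin; apply: lee_sum => k _.
under eq_bigr do rewrite big_cons.
rewrite -mulr_sumr EFinM; apply: lee_wpmul2l; first by rewrite lee_fin.
apply: (le_trans (IH _)); apply: le_measure; rewrite ?inE//.
  apply: closed_borel_measurable; apply: closed_preimage_mapW.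
  exact: closed_cylinders.
exact: cylindersS_preimage.
Qed.

(** * The dimension bound *)

Lemma geometric_eventually_le {R : realType} (r e : R) :
  0 <= r -> r < 1 -> 0 < e -> exists N, forall m, (N <= m)%N -> r ^+ m <= e.
Proof.
move=> r0 r1 e0; have r1' : `|r| < 1 by rewrite ger0_norm.
have /cvgr0Pnorm_le/(_ _ e0)[N _ HN] := @cvg_expr _ r r1'.
by exists N => m /HN /=; apply: le_trans; exact: ler_norm.
Qed.

Lemma powR_prod {R : realType} (I : Type) (w : seq I) (f : I -> R) (s : R) :
  (forall i, 0 <= f i) -> (\prod_(i <- w) f i) `^ s = \prod_(i <- w) f i `^ s.
Proof.
move=> f0; elim: w => [|i w IH]; first by rewrite !big_nil powR1.
by rewrite !big_cons powRM ?IH//; exact: prodr_ge0.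
Qed.

(** Since the sum of the [p k * ln (C k)] is negative, the last hypothesis says
that [s] exceeds the ratio in the dimension bound. *)
Lemma exists_hausdorff_null {R : realType} {n M : nat} (D : fif_data R n M)
    (C : 'I_n -> R) (h : R -> 'rV[R]_M) (p : 'I_n -> R)
    (mu : probability (borel_space R M) R) (s : R) :
  (forall k, 0 < C k < 1) ->
  (forall (k : 'I_n) (u v : ambient R M),
      ifs_space D u -> ifs_space D v ->
      euclid_dist (mapW D k u) (mapW D k v) <= C k * euclid_dist u v) ->
  is_fif D h -> is_probability_vector p -> is_invariant_measure D h p mu ->
  0 < s -> s * \sum_k p k * ln (C k) < \sum_k p k * ln (p k) ->
  exists F : set (borel_space R M), [/\ measurable F, (0 < mu F)%E &
    hausdorff_measure (@euclid_dist R M) s F = 0%E].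
Proof.
move=> hC hW hh [p0 p1] hmu s0 hs.
have C0 k : 0 < C k by case/andP: (hC k).
pose x k := s * ln (C k) - ln (p k).
have px : \sum_k p k * x k < 0.
  under eq_bigr do rewrite /x mulrBr mulrCA.
  by rewrite sumrB -mulr_sumr subr_lt0.
have [t [r [t0 t1 r0 r1 tr]]] := exp_moment_lt1 _ _ _ p0 p1 px.
pose good m (w : seq 'I_n) := \prod_(k <- w) expR (t * x k) <= r ^+ m.
have gb m := sum_good_bad _ _ _ _ p0 p1 t0 t1 r0 r1 tr m.
set K := graphJ D h.
have [_ [_ Kc Ks Kinv]] := hh.
have Kk k : mapW D k @` K `<=` K by move=> u Wu; rewrite /K Kinv; exists k.
pose E m : set (borel_space R M) := cylinders D K m (good m).
have mE m : measurable (E m).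
  by apply: closed_borel_measurable; exact: closed_cylinders.
have muE m : (mu (~` E m) <= (r ^+ m)%:E)%E.
  rewrite probability_setC// leeBlDr ?fin_num_measure//.
  apply: (@le_trans _ _ ((r ^+ m)%:E +
      (\sum_(w <- words m | good m w) \prod_(k <- w) p k)%:E)%E); last first.
    rewrite leeD2l//; apply: measure_cylinders_ge => //.
    by move=> k; exact: ltW.
  rewrite -EFinD lee_fin.
  have : \sum_(w <- words m) \prod_(k <- w) p k = 1.
    by rewrite sum_words_prod p1 expr1n.
  rewrite (bigID (good m))/= => sum1.
  have bad : \sum_(w <- words m | ~~ good m w) \prod_(k <- w) p k <= r ^+ m.
    by have [] := gb m.
  by lra.
(* Along the lengths [mm j], the measures of the complements are at most
   [1/4, 1/16, ...], hence have a sum at most [1/2]. *)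
have [m1 rm1] : exists N, forall m, (N <= m)%N -> r ^+ m <= 4^-1.
  by apply: geometric_eventually_le; lra.
pose mm j := (m1.+1 * j.+1)%N.
have jmm j : (j <= mm j)%N.
  by rewrite /mm mulSn (leq_trans (leqnSn j))// leq_addr.
have rmm j : r ^+ mm j <= 2^-1 / (2 ^ j.+1)%:R.
  rewrite exprM; apply: (@le_trans _ _ (4^-1 ^+ j.+1)).
    apply: lerXn2r; last exact: rm1.
      by rewrite nnegrE exprn_ge0// ltW.
    by rewrite nnegrE invr_ge0.
  have -> : 4^-1 = 2^-1 * 2^-1 :> R by lra.
  rewrite exprMn natrX -exprVn ler_pM2r ?exprn_gt0 ?invr_gt0//.
  rewrite exprS ger_pMr ?exprn_ile1//; lra.
pose F := \bigcap_j E (mm j).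
have mF : measurable F by apply: bigcapT_measurable.
exists F; split => //.
- have muF : (mu (~` F) <= (2^-1)%:E)%E.
    apply: (@le_trans _ _ (\sum_(0 <= j <oo) mu (~` E (mm j)))%E).
      apply: measure_sigma_subadditive.
      + by move=> j; exact: measurableC.
      + exact: measurableC.
      + by rewrite /F setC_bigcap.
    apply: (le_trans _ (epsilon_trick0 xpredT _)); last by lra.
    apply: lee_nneseries => // j _; apply: (le_trans (muE _)).
    by rewrite lee_fin.
  rewrite lt0e measure_ge0 andbT; apply/eqP => F0.
  by move: muF; rewrite probability_setC// F0 sube0 lee_fin; lra.
- have [d d0 Kd] := compact_euclid_bounded _ Kc.
  apply: hausdorff_measure_eq0 => //; first exact: euclid_dist_ge0.
  move=> delta e delta0 e0.
  pose c := \big[Num.max/0]_(k < n) C k.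
  have c0 : 0 <= c by apply: bigmax_ge_id.
  have c1 : c < 1 by apply: bigmax_lt => // k _; case/andP: (hC k).
  have Cc k : C k <= c by exact: le_bigmax.
  have Cw0 (w : seq 'I_n) : 0 < \prod_(k <- w) C k by apply: prodr_gt0.
  have ds0 : 0 < d `^ s by exact: powR_gt0.
  have [N1 HN1] := geometric_eventually_le _ _ c0 c1 (divr_gt0 delta0 d0).
  have [N2 HN2] := geometric_eventually_le _ _ (ltW r0) r1 (divr_gt0 e0 ds0).
  pose m := mm (maxn N1 N2).
  have N1m : (N1 <= m)%N by rewrite (leq_trans (leq_maxl N1 N2))// jmm.
  have N2m : (N2 <= m)%N by rewrite (leq_trans (leq_maxr N1 N2))// jmm.
  (* One level of the intersection already covers [F]. *)
  exists (seq 'I_n), [seq w <- words m | good m w], (cylinder D K),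
    (fun w => (\prod_(k <- w) C k) * d); split.
  + by move=> u /(_ (maxn N1 N2) I).
  + by apply: cylinder_dist_le => // k; exact: ltW.
  + move=> w; rewrite mem_filter => /andP[_ /size_words wm].
    rewrite mulr_ge0 ?(ltW d0) ?(ltW (Cw0 _))//= -ler_pdivlMr//.
    apply: le_trans (HN1 _ N1m); rewrite -wm.
    elim: (w) => [|k v IH]; first by rewrite big_nil.
    by rewrite big_cons exprS; apply: ler_pM => //; exact: ltW.
  + rewrite big_filter.
    have -> : \sum_(w <- words m | good m w) ((\prod_(k <- w) C k) * d) `^ s =
        (\sum_(w <- words m | good m w) \prod_(k <- w) (p k * expR (x k))) *
        d `^ s.
      rewrite mulr_suml; apply: eq_bigr => w _.
      rewrite powRM ?(ltW d0) ?(ltW (Cw0 _))//; congr (_ * _).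
      rewrite powR_prod; last by move=> k; exact: ltW.
      apply: eq_bigr => k _; rewrite /x expRD expRN lnK ?posrE//.
      by rewrite mulrCA divff ?mulr1 ?gt_eqF// /powR gt_eqF.
    rewrite -ler_pdivlMr//; apply: le_trans (HN2 _ N2m).
    by have [] := gb m.
Qed.

Theorem theorem3p15 (R : realType) (n M : nat) (hn : (2 <= n)%N)
    (hM : (1 <= M)%N) (D : fif_data R n M)
    (C : 'I_n -> R) (hC : forall k, 0 < C k < 1)
    (hW : forall (k : 'I_n) (u v : ambient R M),
      ifs_space D u -> ifs_space D v ->
      euclid_dist (mapW D k u) (mapW D k v) <= C k * euclid_dist u v)
    (h : R -> 'rV[R]_M) (hh : is_fif D h)
    (p : 'I_n -> R) (hp : is_probability_vector p)
    (mu : probability (borel_space R M) R)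
    (hmu : is_invariant_measure D h p mu) :
  (measure_hausdorff_dim mu <=
    ((\sum_(k < n) p k * ln (p k)) / (\sum_(k < n) p k * ln (C k)))%:E)%E.
Proof.
have [p0 p1] := hp.
set A := \sum_k p k * ln (p k); set B := \sum_k p k * ln (C k).
have p_le1 k : p k <= 1.
  rewrite -p1 (bigD1 k)//= lerDl.
  by apply: sumr_ge0 => j _; exact: ltW.
have A0 : A <= 0.
  by apply: sumr_le0 => k _; rewrite pmulr_rle0//; exact: ln_le0.
have B0 : B < 0.
  rewrite /B (bigD1 (Ordinal (ltnW hn)))//= ltr_wnDr//.
    by apply: sumr_le0 => k _; rewrite pmulr_rle0// ln_le0// ltW//;
      case/andP: (hC k).
  by rewrite pmulr_rlt0// ln_lt0.
apply/lee_addgt0Pr => e e0.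
pose s := A / B + e.
have s0 : 0 < s by rewrite ltr_wpDl// mulr_le0// invr_le0 ltW.
have sB : s * B < A.
  by rewrite mulrDl divfK ?lt_eqF// gtrDl pmulr_rlt0.
have [F [mF F0 HF]] := exists_hausdorff_null D C h p mu s hC hW hh hp hmu s0 sB.
apply: (@le_trans _ _ (hausdorff_dim (@euclid_dist R M) F)).
  by apply: ereal_inf_lbound; exists F.
by apply: ereal_inf_lbound; exists s => //; split=> //; exact: ltW.
Qed.
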